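(* Every finite-dimensional congruence representation of $\operatorname{SL}_2(\mathbb{Z})$ over $\mathbb{C}$ is symmetrizable.
   Context: Let $\mathfrak{s}=\begin{pmatrix}0&1\\-1&0\end{pmatrix}$ and $\mathfrak{t}=\begin{pmatrix}1&1\\0&1\end{pmatrix}$, generators of $\operatorname{SL}_2(\mathbb{Z})$. All representations are finite-dimensional over $\mathbb{C}$. $\operatorname{U}(n)$ is the group of $n\times n$ unitary complex matrices. A unitary matrix representation $\rho:\operatorname{SL}_2(\mathbb{Z})\to\operatorname{U}(n)$ is called symmetric if $\rho(\mathfrak{s})$ is a symmetric matrix ($\rho(\mathfrak{s})^{\top}=\rho(\mathfrak{s})$) and $\rho(\mathfrak{t})$ is a diagonal matrix. A finite-dimensional representation $\operatorname{SL}_2(\mathbb{Z})\to\operatorname{GL}(V)$ is called symmetrizable if it is equivalent (isomorphic) to a symmetric representation. A finite-dimensional representation $\rho$ of $\operatorname{SL}_2(\mathbb{Z})$ is called congruence of level $n$ if $\ker(\rho)$ is a congruence subgroup of level $n$ (i.e. $n$ is the least positive integer such that $\ker(\rho)$ contains the kernel of the reduction map $\operatorname{SL}_2(\mathbb{Z})\to\operatorname{SL}_2(\mathbb{Z}/n\mathbb{Z})$), and congruence if it is congruence of some level. *)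

(* Defs.v *)
From HB Require Import structures.
From mathcomp Require Import all_boot all_order all_algebra.
From mathcomp Require Import reals.
From mathcomp Require Import complex.

Set Implicit Arguments.
Unset Strict Implicit.
Unset Printing Implicit Defensive.

Import Order.TTheory GRing.Theory Num.Theory.
Local Open Scope ring_scope.
Local Open Scope complex_scope.

Record SL2Z := MkSL2Z { sl2z_val :> 'M[int]_2; _ : \det sl2z_val == 1 }.

HB.instance Definition _ := [isSub for sl2z_val].
HB.instance Definition _ := [Choice of SL2Z by <:].

Lemma sl2z_det (g : SL2Z) : \det g = 1.
Proof. by case: g => A /= /eqP. Qed.

Fact sl2z_one_subproof : \det (1%:M : 'M[int]_2) == 1.
Proof. by rewrite det1. Qed.

Fact sl2z_mul_subproof (g h : SL2Z) :
  \det ((g : 'M[int]_2) *m (h : 'M[int]_2)) == 1.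
Proof. by rewrite det_mulmx !sl2z_det mulr1. Qed.

Fact sl2z_inv_subproof (g : SL2Z) : \det (\adj (g : 'M[int]_2)) == 1.
Proof.
have /(congr1 determinant) := mul_mx_adj (g : 'M[int]_2).
by rewrite det_mulmx sl2z_det mul1r det1 => ->.
Qed.

Definition sl2z_one : SL2Z := MkSL2Z sl2z_one_subproof.
Definition sl2z_mul (g h : SL2Z) : SL2Z := MkSL2Z (sl2z_mul_subproof g h).
(* For a matrix of determinant 1 the adjugate is the inverse. *)
Definition sl2z_inv (g : SL2Z) : SL2Z := MkSL2Z (sl2z_inv_subproof g).

Fact sl2z_mulA : associative sl2z_mul.
Proof. by move=> g h k; apply: val_inj; rewrite /= mulmxA. Qed.

Fact sl2z_mul1 : left_id sl2z_one sl2z_mul.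
Proof. by move=> g; apply: val_inj; rewrite /= mul1mx. Qed.

Fact sl2z_mulr1 : right_id sl2z_one sl2z_mul.
Proof. by move=> g; apply: val_inj; rewrite /= mulmx1. Qed.

Fact sl2z_mulV : left_inverse sl2z_one sl2z_inv sl2z_mul.
Proof. by move=> g; apply: val_inj; rewrite /= mul_adj_mx sl2z_det. Qed.

Fact sl2z_mulrV : right_inverse sl2z_one sl2z_inv sl2z_mul.
Proof. by move=> g; apply: val_inj; rewrite /= mul_mx_adj sl2z_det. Qed.

HB.instance Definition _ :=
  isGroup.Build SL2Z sl2z_mulA sl2z_mul1 sl2z_mulr1 sl2z_mulV sl2z_mulrV.

Definition mx22 (a b c d : int) : 'M[int]_2 :=
  \matrix_(i, j) nth 0 (nth [::] [:: [:: a; b]; [:: c; d]] i) j.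

Fact det_mx22_expand (a b c d : int) : \det (mx22 a b c d) = a * d - b * c.
Proof.
rewrite (expand_det_row _ ord0) !big_ord_recl big_ord0 /cofactor !det_mx11.
by rewrite !mxE /= expr0 expr1 mul1r mulN1r mulrN addr0.
Qed.

Fact sl2z_s_subproof : \det (mx22 0 1 (-1) 0) == 1.
Proof. by rewrite det_mx22_expand. Qed.

Fact sl2z_t_subproof : \det (mx22 1 1 0 1) == 1.
Proof. by rewrite det_mx22_expand. Qed.

Definition sl2z_s : SL2Z := MkSL2Z sl2z_s_subproof.
Definition sl2z_t : SL2Z := MkSL2Z sl2z_t_subproof.

(* The kernel of the reduction map SL_2(Z) -> SL_2(Z/nZ). Stated entrywise with
   integer congruences, since 'Z_1 is not the trivial ring. *)
Definition Gamma (n : nat) (g : SL2Z) : Prop :=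
  forall i j : 'I_2,
    ((g : 'M[int]_2) i j = (1%:M : 'M[int]_2) i j %[mod n])%Z.

Definition congruence_subgroup_of_level (K : SL2Z -> Prop) (n : nat) : Prop :=
  [/\ (0 < n)%N,
      forall g, Gamma n g -> K g
    & forall m, (0 < m)%N -> (forall g, Gamma m g -> K g) -> (n <= m)%N].

(* Homomorphisms SL_2(Z) -> GL(V): the two laws force each rho g to be
   invertible, with inverse rho g^-1. *)
Definition is_representation (F : fieldType) (V : vectType F)
    (rho : SL2Z -> 'End(V)) : Prop :=
  rho 1%g = \1%VF /\ forall g h : SL2Z, rho (g * h)%g = (rho g \o rho h)%VF.

Definition rep_ker (F : fieldType) (V : vectType F) (rho : SL2Z -> 'End(V))
  (g : SL2Z) : Prop := rho g = \1%VF.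

Definition congruence_of_level (F : fieldType) (V : vectType F)
    (rho : SL2Z -> 'End(V)) (n : nat) : Prop :=
  congruence_subgroup_of_level (rep_ker rho) n.

Definition congruence (F : fieldType) (V : vectType F)
    (rho : SL2Z -> 'End(V)) : Prop :=
  exists n, congruence_of_level rho n.

Definition is_unitary_mx_representation (R : realType) (n : nat)
    (sigma : SL2Z -> 'M[R[i]]_n) : Prop :=
  [/\ forall g, sigma g \is unitarymx,
      sigma 1%g = 1%:M
    & forall g h : SL2Z, sigma (g * h)%g = sigma g *m sigma h].

Definition symmetric_representation (R : realType) (n : nat)
    (sigma : SL2Z -> 'M[R[i]]_n) : Prop :=
  [/\ is_unitary_mx_representation sigma,
      (sigma sl2z_s)^T = sigma sl2z_s
    & is_diag_mx (sigma sl2z_t)].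

(* Matrices act on column vectors, on the left. *)
Definition equivalent_to_mx (F : fieldType) (V : vectType F) (n : nat)
    (rho : SL2Z -> 'End(V)) (sigma : SL2Z -> 'M[F]_n) : Prop :=
  exists phi : 'Hom(V, 'cV[F]_n),
    bijective phi /\ forall g v, phi (rho g v) = sigma g *m phi v.

Definition symmetrizable (R : realType) (V : vectType R[i])
    (rho : SL2Z -> 'End(V)) : Prop :=
  exists (n : nat) (sigma : SL2Z -> 'M[R[i]]_n),
    symmetric_representation sigma /\ equivalent_to_mx rho sigma.

(* Main.v *)
Require Import Defs.
From HB Require Import structures.
From mathcomp Require Import all_boot all_order all_algebra.
From mathcomp Require Import reals.
From mathcomp Require Import complex.
From mathcomp Require Import cyclic separable cyclotomic.
From mathcomp Require Import boolp.
From mathcomp Require Import ring.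

(** Let tau be conjugation by diag(1, -1); it inverts the generators
s and t.  A unitary matrix representation sigma is symmetric, with sigma(t)
diagonal, as soon as the entrywise complex conjugate of sigma is sigma o tau
and the basis consists of t-eigenvectors: then the conjugate of sigma(s) is
sigma(s)^-1, that is, the conjugate transpose of sigma(s).  So the task is to
put on the representation space V, with an invariant inner product (obtained by
averaging over the finite image), a real structure J, i.e. an antiunitary
involution with J rho(g) = rho(tau g) J, and then to choose an orthonormal
basis of J-fixed t-eigenvectors.  This last choice is possible because
J rho(t) J = rho(t)^-1, so that J commutes with the spectral projections of
rho(t).

To get J on the cyclic subspace generated by a vector v, put
J (sum_g c_g rho(g) v) = sum_g conj(c_g) rho(tau g) v.  This is well defined
and antiunitary exactly when phi(g) = <rho(g) v, v> satisfies
phi(tau g) = conj phi(g) = phi(g^-1).  It holds by a Gelfand-type argument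
(gelfand_symmetry) whenever v is fixed by Gamma(m) and t v = lambda v with
lambda a primitive m-th root of unity: phi is then bi-equivariant under the
upper unipotent group for a primitive character, and every double coset that
can support such a function modulo m is stable under the anti-automorphism
g |-> tau(g)^-1, which swaps the two diagonal entries.

Such vectors exist in every nonzero subrepresentation
(exists_primitive_vector).  Choose m minimal among the levels at which some
nonzero vector is fixed by Gamma(m).  If t^(m/q) acted trivially on
these vectors for some prime q dividing m, then they would be fixed by
Gamma(m/q), because t^(m/q) normally generates Gamma(m/q) modulo Gamma(m),
already under the q-part of SL2(Z/m) (Gamma_generated).  Conjugating by that
q-part only is what allows one to treat the primes dividing m one after the
other, since it commutes with t^(m/p) for the other primes p.

Splitting off orthogonal complements repeatedly, V is an orthogonal sum of
cyclic subspaces of this kind, and J is defined on the sum.  It is encoded as a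
relation (conj_rel) between combinations of the rho(g) v and their conjugate
combinations; its being antiunitary makes it independent of the presentation. *)

Set Implicit Arguments.
Unset Strict Implicit.
Unset Printing Implicit Defensive.

Import Order.TTheory GRing.Theory Num.Theory.
Local Open Scope ring_scope.

(** * Coordinates on SL2(Z) and congruences between matrices *)

Definition ea (g : SL2Z) : int := (g : 'M[int]_2) 0 0.
Definition eb (g : SL2Z) : int := (g : 'M[int]_2) 0 1.
Definition ec (g : SL2Z) : int := (g : 'M[int]_2) 1 0.
Definition ed (g : SL2Z) : int := (g : 'M[int]_2) 1 1.

Lemma ord2P (P : 'I_2 -> Prop) : P 0 -> P 1 -> forall i, P i.
Proof.
move=> P0 P1 [[|[|//]] Hi].
- by rewrite (_ : Ordinal Hi = 0) //; apply: val_inj.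
- by rewrite (_ : Ordinal Hi = 1) //; apply: val_inj.
Qed.

Lemma mx22E (A : 'M[int]_2) : A = mx22 (A 0 0) (A 0 1) (A 1 0) (A 1 1).
Proof. by apply/matrixP; do 2!apply: ord2P; rewrite !mxE. Qed.

Lemma sl2z_detE g : ea g * ed g - eb g * ec g = 1.
Proof. by rewrite -det_mx22_expand -(sl2z_det g) [in RHS](mx22E g). Qed.

Lemma mk_sl2z_subproof (a b c d : int) :
  a * d - b * c = 1 -> \det (mx22 a b c d) == 1.
Proof. by move=> E; rewrite det_mx22_expand E. Qed.

Definition mk_sl2z a b c d (E : a * d - b * c = 1) : SL2Z :=
  MkSL2Z (mk_sl2z_subproof E).

Lemma sl2z_eq g h :
  ea g = ea h -> eb g = eb h -> ec g = ec h -> ed g = ed h -> g = h.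
Proof.
rewrite /ea /eb /ec /ed => E1 E2 E3 E4; apply: val_inj.
by rewrite /= (mx22E g) (mx22E h) E1 E2 E3 E4.
Qed.

Section MkEntries.
Variables (a b c d : int) (E : a * d - b * c = 1).
Lemma ea_mk : ea (mk_sl2z E) = a. Proof. by rewrite /ea mxE. Qed.
Lemma eb_mk : eb (mk_sl2z E) = b. Proof. by rewrite /eb mxE. Qed.
Lemma ec_mk : ec (mk_sl2z E) = c. Proof. by rewrite /ec mxE. Qed.
Lemma ed_mk : ed (mk_sl2z E) = d. Proof. by rewrite /ed mxE. Qed.
End MkEntries.
Definition mkE := (ea_mk, eb_mk, ec_mk, ed_mk).

Lemma ea1 : ea 1%g = 1. Proof. by rewrite /ea mxE. Qed.
Lemma eb1 : eb 1%g = 0. Proof. by rewrite /eb mxE. Qed.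
Lemma ec1 : ec 1%g = 0. Proof. by rewrite /ec mxE. Qed.
Lemma ed1 : ed 1%g = 1. Proof. by rewrite /ed mxE. Qed.

Lemma mxM2 (A B : 'M[int]_2) i j : (A *m B) i j = A i 0 * B 0 j + A i 1 * B 1 j.
Proof.
rewrite mxE !big_ord_recl big_ord0 addr0.
by rewrite (_ : lift ord0 ord0 = 1) //; apply: val_inj.
Qed.

Lemma eaM g h : ea (g * h)%g = ea g * ea h + eb g * ec h.
Proof. exact: mxM2. Qed.
Lemma ebM g h : eb (g * h)%g = ea g * eb h + eb g * ed h.
Proof. exact: mxM2. Qed.
Lemma ecM g h : ec (g * h)%g = ec g * ea h + ed g * ec h.
Proof. exact: mxM2. Qed.
Lemma edM g h : ed (g * h)%g = ec g * eb h + ed g * ed h.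
Proof. exact: mxM2. Qed.

Lemma sl2z_invE_subproof g : ed g * ea g - (- eb g) * (- ec g) = 1.
Proof. by rewrite -(sl2z_detE g); ring. Qed.

Lemma sl2z_invE g : (g^-1)%g = mk_sl2z (sl2z_invE_subproof g).
Proof.
apply: mulg1_eq; have := sl2z_detE g => D.
apply: sl2z_eq; rewrite ?(eaM, ebM, ecM, edM) !mkE ?(ea1, eb1, ec1, ed1) -?D; ring.
Qed.

Lemma eaV g : ea (g^-1)%g = ed g. Proof. by rewrite sl2z_invE mkE. Qed.
Lemma ebV g : eb (g^-1)%g = - eb g. Proof. by rewrite sl2z_invE mkE. Qed.
Lemma ecV g : ec (g^-1)%g = - ec g. Proof. by rewrite sl2z_invE mkE. Qed.
Lemma edV g : ed (g^-1)%g = ea g. Proof. by rewrite sl2z_invE mkE. Qed.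

Definition sl2zE := (eaM, ebM, ecM, edM, eaV, ebV, ecV, edV, ea1, eb1, ec1, ed1).

Definition congr_sl2z (m : int) (g h : SL2Z) : bool :=
  [&& (m %| ea g - ea h)%Z, (m %| eb g - eb h)%Z,
      (m %| ec g - ec h)%Z & (m %| ed g - ed h)%Z].

Lemma congr_sl2zP (m : int) g h :
  reflect (exists x : int * int * int * int,
     [/\ ea g = ea h + x.1.1.1 * m, eb g = eb h + x.1.1.2 * m,
         ec g = ec h + x.1.2 * m & ed g = ed h + x.2 * m])
    (congr_sl2z m g h).
Proof.
apply: (iffP and4P) => [[/dvdzP[x X] /dvdzP[y Y] /dvdzP[z Z] /dvdzP[w W]]|].
  by exists (x, y, z, w); split; rewrite /= -(X, Y, Z, W) addrC subrK.
by case=> [[[[x y] z] w]] /= [-> -> -> ->]; split; rewrite addrC addKr dvdz_mull.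
Qed.

Lemma GammaP (m : nat) g : Gamma m g <-> congr_sl2z m g 1%g.
Proof.
rewrite /congr_sl2z ea1 eb1 ec1 ed1 -!eqz_mod_dvd; split=> [H|].
  by apply/and4P; split; apply/eqP; rewrite /ea /eb /ec /ed H mxE.
by case/and4P=> /eqP A /eqP B /eqP C /eqP D; do 2!apply: ord2P; rewrite [in RHS]mxE.
Qed.

Lemma congr_Gamma (m : nat) g h : congr_sl2z m g h -> Gamma m (g * h^-1)%g.
Proof.
case/congr_sl2zP=> [[[[x y] z] w]] /= [A B C D]; apply/GammaP/congr_sl2zP.
exists (x * ed h - y * ec h, y * ea h - x * eb h, z * ed h - w * ec h,
        w * ea h - z * eb h).
by have Dh := sl2z_detE h; split; rewrite !sl2zE /= ?A ?B ?C ?D -?Dh; ring.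
Qed.

Lemma Gamma_conj (m : nat) g h : Gamma m g -> Gamma m (h * g * h^-1)%g.
Proof.
move=> /GammaP/congr_sl2zP[[[[x y] z] w]]; rewrite ea1 eb1 ec1 ed1 /=.
case=> A B C D; suff: congr_sl2z m (h * g)%g h by apply: congr_Gamma.
apply/congr_sl2zP; exists (ea h * x + eb h * z, ea h * y + eb h * w,
  ec h * x + ed h * z, ec h * y + ed h * w).
by split; rewrite !sl2zE /= ?A ?B ?C ?D; ring.
Qed.

Lemma up_subproof (x : int) : 1 * 1 - x * 0 = 1 :> int. Proof. by ring. Qed.
Definition up x := mk_sl2z (up_subproof x).
Lemma low_subproof (x : int) : 1 * 1 - 0 * x = 1 :> int. Proof. by ring. Qed.
Definition low x := mk_sl2z (low_subproof x).

Lemma upD x y : up (x + y) = (up x * up y)%g.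
Proof. by apply: sl2z_eq; rewrite !sl2zE !mkE; ring. Qed.
Lemma up0 : up 0 = 1%g.
Proof. by apply: sl2z_eq; rewrite !sl2zE !mkE. Qed.
Lemma upN x : up (- x) = ((up x)^-1)%g.
Proof. by apply: sl2z_eq; rewrite !sl2zE !mkE; ring. Qed.
Lemma up1 : up 1 = sl2z_t.
Proof. by apply: sl2z_eq; rewrite !mkE /ea /eb /ec /ed !mxE. Qed.
Lemma Gamma_up (m : nat) x : (m %| x)%Z -> Gamma m (up x).
Proof.
move=> mx; apply/GammaP; rewrite /congr_sl2z !mkE !sl2zE !subrr subr0.
by rewrite mx !dvdz0.
Qed.

Lemma ea_conj_up h x : ea (h * up x * h^-1)%g = 1 - ea h * x * ec h.
Proof. by rewrite -(sl2z_detE h) !sl2zE !mkE; ring. Qed.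
Lemma eb_conj_up h x : eb (h * up x * h^-1)%g = ea h ^+ 2 * x.
Proof. by rewrite !sl2zE !mkE; ring. Qed.
Lemma ec_conj_up h x : ec (h * up x * h^-1)%g = - ec h ^+ 2 * x.
Proof. by rewrite !sl2zE !mkE; ring. Qed.
Lemma ed_conj_up h x : ed (h * up x * h^-1)%g = 1 + ea h * x * ec h.
Proof. by rewrite -(sl2z_detE h) !sl2zE !mkE; ring. Qed.
Definition conj_upE := (ea_conj_up, eb_conj_up, ec_conj_up, ed_conj_up).

Lemma congr_mulr (m : int) g g' h :
  congr_sl2z m g g' -> congr_sl2z m (g * h)%g (g' * h)%g.
Proof.
case/congr_sl2zP=> [[[[x y] z] w]] /= [A B C D]; apply/congr_sl2zP.
exists (x * ea h + y * ec h, x * eb h + y * ed h,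
        z * ea h + w * ec h, z * eb h + w * ed h).
by split; rewrite !sl2zE /= ?A ?B ?C ?D; ring.
Qed.

Lemma Gamma1 (m : nat) : Gamma m 1%g. Proof. by move=> i j. Qed.

Lemma bezout_coprime (m n : nat) : coprime m n ->
  exists u v : int, u * m%:Z + v * n%:Z = 1.
Proof.
move=> /eqP co; have [u [v E]] := Bezoutz m%:Z n%:Z.
by exists u, v; rewrite E /gcdz /= co.
Qed.

Lemma Gamma_low (m : nat) x : (m %| x)%Z -> Gamma m (low x).
Proof.
move=> mx; apply/GammaP; rewrite /congr_sl2z !mkE !sl2zE !subrr subr0.
by rewrite mx !dvdz0.
Qed.

Lemma GammaM (m : nat) g h : Gamma m g -> Gamma m h -> Gamma m (g * h)%g.
Proof.
move=> /GammaP/congr_sl2zP[[[[x y] z] w]]; rewrite ea1 eb1 ec1 ed1 /=.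
case=> A B C D /GammaP/congr_sl2zP[[[[x' y'] z'] w']].
rewrite ea1 eb1 ec1 ed1 /= => [[A' B' C' D']]; apply/GammaP/congr_sl2zP.
exists (x + x' + x * x' * m + y * z' * m, y + y' + x * y' * m + y * w' * m,
  z + z' + z * x' * m + w * z' * m, w + w' + z * y' * m + w * w' * m).
by split; rewrite !sl2zE /= ?A ?B ?C ?D ?A' ?B' ?C' ?D'; ring.
Qed.

Lemma GammaV (m : nat) g : Gamma m g -> Gamma m (g^-1)%g.
Proof.
move=> /GammaP/and4P[]; rewrite !sl2zE !subr0 => A B C' D.
by apply/GammaP/and4P; split; rewrite !sl2zE ?subr0 ?rpredN.
Qed.

(** Here up (m / p) is congruent to 1 modulo the q-part of m while h is
congruent to 1 modulo the complementary part, so their commutator lies in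
Gamma m: the q-part and the p-part of SL2(Z/m) commute. *)
Lemma congr_up_commute (m q p : nat) h : (0 < m)%N -> prime p -> prime q ->
  (p %| m)%N -> p != q -> Gamma m`_q^' h ->
  congr_sl2z m (up (m %/ p)%N * h)%g (h * up (m %/ p)%N)%g.
Proof.
move=> m_gt0 pr_p pr_q p_m p_neq_q /GammaP/congr_sl2zP[[[[a b] c] d]].
rewrite ea1 eb1 ec1 ed1 /= => -[aE bE cE dE].
have [r rE] : exists r : int, (m %/ p)%N%:Z * (m`_q^')%N%:Z = r * m%:Z.
  have : (p %| m`_q^')%N.
    have cop : coprime p m`_q.
      apply: (@pnat_coprime p); rewrite ?pnat_id //.
      by apply: sub_in_pnat (part_pnat q m) => r _ /eqP->; rewrite !inE eq_sym.
    by rewrite -(Gauss_dvdr _ cop) partnC.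
  case/dvdnP=> r rE; exists r%:Z; rewrite -!PoszM; congr Posz.
  apply/eqP; rewrite -(eqn_pmul2r (prime_gt0 pr_p)); apply/eqP.
  by rewrite mulnAC divnK // rE; ring.
apply/congr_sl2zP.
have E z : (m %/ p)%N%:Z * (z * (m`_q^')%N%:Z) = z * r * m%:Z.
  by rewrite mulrCA rE; ring.
exists (c * r, d * r - a * r, 0, - (c * r)).
rewrite !sl2zE !mkE cE aE dE /=.
have {}E z : z * (m`_q^')%N%:Z * (m %/ p)%N%:Z = z * r * m%:Z by rewrite mulrC E.
split; rewrite ?mulrDl ?mulNr ?mulrBl -?E; ring.
Qed.

(** * Normal generation of congruence subgroups *)

(** The relation a d = 1 + b c determines d modulo m once a is invertible. *)
Lemma congr_ed (m : int) g h : coprimez m (ea g) ->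
  (m %| ea g - ea h)%Z -> (m %| eb g - eb h)%Z -> (m %| ec g - ec h)%Z ->
  congr_sl2z m g h.
Proof.
move=> cop A B C; apply/and4P; split=> //.
rewrite -(Gauss_dvdzr _ cop).
have -> : ea g * (ed g - ed h) = (eb g - eb h) * ec g + eb h * (ec g - ec h)
          - (ea g - ea h) * ed h.
  have Eg := sl2z_detE g; have Eh := sl2z_detE h.
  have -> : ea g * (ed g - ed h) = ea g * ed g - ea h * ed h - (ea g - ea h) * ed h by ring.
  have -> : ea g * ed g = 1 + eb g * ec g by rewrite -Eg; ring.
  have -> : ea h * ed h = 1 + eb h * ec h by rewrite -Eh; ring.
  by ring.
by rewrite rpredB ?rpredD //; [exact: dvdz_mulr|exact: dvdz_mull|exact: dvdz_mulr].
Qed.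

Section GammaGenerated.
Variables (N : SL2Z -> Prop) (m q : nat).
Hypotheses (pr_q : prime q) (q_dvd_m : (q %| m)%N).
Hypothesis N_M : forall g h, N g -> N h -> N (g * h)%g.
Hypothesis N_V : forall g, N g -> N (g^-1)%g.
Hypothesis N_Gamma : forall g, Gamma m g -> N g.
Hypothesis N_t : N (up (m %/ q)%N).
Hypothesis N_J : forall g h, Gamma m`_q^' h -> N g -> N (h * g * h^-1)%g.
Let l : nat := (m %/ q)%N.

Let mE : m%:Z = q%:Z * l%:Z. Proof. by rewrite -PoszM mulnC divnK. Qed.

Let N_congr g h : congr_sl2z m g h -> N h -> N g.
Proof.
by move=> /congr_Gamma/N_Gamma E /(N_M E); rewrite mulgVK.
Qed.

Let N_up x : N (up (l%:Z * x)).
Proof.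
have pos (k : nat) : N (up (l%:Z * k%:Z)).
  elim: k => [|k IHk]; first by rewrite mulr0 up0; apply/N_Gamma/Gamma1.
  by rewrite intS mulrDr mulr1 upD; apply: N_M.
by case: x => k; [|rewrite NegzE mulrN upN; apply: N_V]; apply: pos.
Qed.

(* up e and low e lie in the group by which N may be conjugated; on up (l x) they
   act modulo m as up 1 and low 1 would, since l (e - 1) is divisible by m. *)
Let idempotent_lift : exists u e : int,
  e = 1 - u * q%:Z /\ ((m`_q^')%N%:Z %| e)%Z.
Proof.
have /bezout_coprime[u [v E]] : coprime q m`_q^'.
  by apply: (@pnat_coprime q); rewrite ?pnat_id ?part_pnat.
by exists u, (v * (m`_q^')%N%:Z); rewrite -E dvdz_mull // addrC addKr.
Qed.

Let N_low x : N (low (l%:Z * x)).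
Proof.
have [u [e [eE m'e]]] := idempotent_lift.
(* h is congruent to s modulo q and to 1 modulo the prime-to-q part of m: on
   up (l x) it acts like s, which exchanges upper and lower unipotents. *)
pose h := (up e * low (- e) * up e)%g.
have Gh : Gamma m`_q^' h.
  by do !apply: GammaM; (apply: Gamma_up || apply: Gamma_low); rewrite ?rpredN.
apply: N_congr (N_J Gh (N_up (- x))); apply/congr_sl2zP.
have eah : ea h = u * q%:Z * (1 + e).
  by rewrite /h !sl2zE !mkE eE; ring.
have ech : ec h = - e by rewrite /h !sl2zE !mkE; ring.
exists (u * (1 + e) * (- x) * (- e), u * u * q%:Z * (1 + e) ^+ 2 * x,
  x * u * (1 + e), u * (1 + e) * x * (-e)).
by rewrite !mkE !conj_upE eah ech mE /= eE; split; ring.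
Qed.

(* When the corner a = 1 + x l of g is invertible modulo m, the conjugate of
   up (- l x) by low e has the same corner modulo m, and two elements with the
   same invertible corner differ by unipotent factors on both sides. *)
Let N_unit g : Gamma l g -> coprimez m (ea g) -> N g.
Proof.
move=> /GammaP/congr_sl2zP[[[[x b] c] d]]; rewrite ea1 eb1 ec1 ed1 /=.
case=> aE bE cE _ cop; have [u [e [eE m'e]]] := idempotent_lift.
have [a' [v inv]] : exists a' v : int, a' * ea g + v * m%:Z = 1.
  have [v [a' E]] := Bezoutz m (ea g); exists a', v.
  by rewrite addrC E; apply/eqP.
move: (N_J (Gamma_low m'e) (N_up (- x))).
move: (ea_conj_up (low e) (l%:Z * - x)) (eb_conj_up (low e) (l%:Z * - x))
  (ec_conj_up (low e) (l%:Z * - x)); rewrite !mkE.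
move: (low e * _ * _)%g => D eaD ebD ecD ND.
pose Y := a' * (c - x); pose Z := a' * (b + x).
apply: N_congr (N_M (N_M (N_low Y) ND) (N_up Z)).
apply: congr_ed => //; rewrite !(eaM, ebM, ecM) ?eaD ?ebD ?ecD !mkE.
- apply/dvdzP; exists (x * u).
  by rewrite aE eE mE; ring.
- apply/dvdzP; exists (u * x * l%:Z * Z + (b + x) * v * l%:Z).
  rewrite bE.
  have -> : b * l%:Z = (b + x) * l%:Z * (a' * ea g + v * m%:Z) - x * l%:Z.
    by rewrite inv; ring.
  by rewrite /Z aE eE mE; ring.
- apply/dvdzP; exists ((c - x) * v * l%:Z + u * x * l%:Z * Y + x * u * (2 - u * q%:Z)).
  rewrite cE.
  have -> : c * l%:Z = (c - x) * l%:Z * (a' * ea g + v * m%:Z) + x * l%:Z.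
    by rewrite inv; ring.
  by rewrite /Y aE eE mE; ring.
Qed.

(** The element t^(m/q) normally generates Gamma (m / q) modulo Gamma m, even
when conjugation is restricted to the q-part of SL2(Z/m).  Elements whose corner
is invertible modulo m are covered by N_unit, and up l moves every other element
into that case. *)
Lemma Gamma_generated g : Gamma l g -> N g.
Proof.
move=> Gg; case/GammaP/congr_sl2zP: (Gg) => [[[[x b] c] d]].
rewrite ea1 eb1 ec1 ed1 /= => [[aE bE cE _]].
have cop_l : coprimez l (ea g).
  by rewrite /coprimez aE addrC gcdzMDl gcdzC gcd1z.
have [q_dvd_a|q_ndvd_a] := boolP (q%:Z %| ea g)%Z; last first.
  apply: N_unit => //; rewrite mE coprimezMl cop_l andbT.
  by rewrite coprimezE prime_coprime.
(* if q divides the corner entry, adding l times the row below repairs it *)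
have q_ndvd_l : ~~ (q%:Z %| l%:Z)%Z.
  apply/negP=> ql; have : (q%:Z %| ea g - x * l%:Z)%Z by rewrite rpredB ?dvdz_mull.
  by rewrite aE addrK dvdz1 /=; case: q pr_q => [|[]].
have q_ndvd_c : ~~ (q%:Z %| ec g)%Z.
  apply/negP=> qc; have : (q%:Z %| ea g * ed g - eb g * ec g)%Z.
    by apply: rpredB; [exact: dvdz_mulr|exact: dvdz_mull].
  by rewrite sl2z_detE dvdz1 /=; case: q pr_q => [|[]].
have Ng : N (up l%:Z * g)%g.
  apply: N_unit; first by apply: GammaM => //; apply: Gamma_up.
  rewrite mE coprimezMl; apply/andP; split; last first.
    by rewrite eaM !mkE mul1r /coprimez addrC mulrC gcdzMDl.
  rewrite coprimezE prime_coprime // eaM !mkE mul1r.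
  change (~~ (q%:Z %| ea g + l%:Z * ec g)%Z).
  rewrite rpredDl // dvdzE abszM Euclid_dvdM // -!dvdzE negb_or.
  by rewrite q_ndvd_l.
by rewrite -(mulKg (up l%:Z) g); apply: N_M Ng; apply: N_V; rewrite -[l%:Z]mulr1.
Qed.
End GammaGenerated.

(** * Conjugation by diag(1, -1) and the double cosets of the unipotent group *)

Lemma twist_subproof g : ea g * ed g - (- eb g) * (- ec g) = 1.
Proof. by rewrite -(sl2z_detE g); ring. Qed.
(** Conjugation by diag(1, -1). *)
Definition twist g := mk_sl2z (twist_subproof g).

Lemma twistM g h : twist (g * h)%g = (twist g * twist h)%g.
Proof. by apply: sl2z_eq; rewrite !(mkE, sl2zE) ?mkE; ring. Qed.
Lemma twistK g : twist (twist g) = g.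
Proof. by apply: sl2z_eq; rewrite !mkE ?opprK. Qed.
Lemma twistV g : twist (g^-1)%g = ((twist g)^-1)%g.
Proof. by apply: sl2z_eq; rewrite !(mkE, sl2zE) ?mkE. Qed.
Lemma twist_s : twist sl2z_s = (sl2z_s^-1)%g.
Proof. by apply: sl2z_eq; rewrite !(mkE, sl2zE) /ea /ed ?mxE. Qed.
Lemma twist_up x : twist (up x) = ((up x)^-1)%g.
Proof. by apply: sl2z_eq; rewrite !(mkE, sl2zE) ?mkE ?oppr0. Qed.

Section GelfandSymmetry.
Variables (F : fieldType) (m : nat) (psi : int -> F) (phi : SL2Z -> F).
Hypothesis m_gt0 : (0 < m)%N.
Hypothesis psi_primitive : forall x, psi x = 1 -> (m %| x)%Z.
Hypothesis phi_congr : forall g h, congr_sl2z m g h -> phi g = phi h.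
Hypothesis phi_up : forall x y g, phi (up x * g * up y)%g = psi (x + y) * phi g.

Let psi0 g : phi g != 0 -> psi 0 = 1.
Proof.
move=> nz; apply: (mulIf nz); rewrite mul1r -[in LHS](addr0 0) -phi_up.
by rewrite up0 mul1g mulg1.
Qed.

(* If x annihilates c modulo m, then up (x a) k up (- x d) is congruent to k, so
   either phi k = 0 or psi is trivial on x (a - d).  For x = m / gcd (c, m) and
   psi primitive, the latter says that gcd (c, m) divides a - d. *)
Let phi_vanish k : ~~ (gcdz (ec k) m %| ea k - ed k)%Z -> phi k = 0.
Proof.
have /dvdzP[c cE] := dvdz_gcdl (ec k) m; have /dvdzP[x mE] := dvdz_gcdr (ec k) m.
move: (gcdz _ _) cE mE => delta cE mE; apply: contraNeq => nz.
have x_nz : x != 0.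
  by apply: contraTneq m_gt0 => x0; rewrite -ltz_nat mE x0 mul0r.
have : (m %| x * (ea k - ed k))%Z; last by rewrite mE dvdz_mul2l.
have -> : x * (ea k - ed k) = x * ea k + - (x * ed k) by ring.
apply: psi_primitive; apply: (mulIf nz); rewrite mul1r -phi_up; apply: phi_congr.
apply/congr_sl2zP.
exists (ea k * c, - x * c * ea k * ed k, 0, - c * ed k).
by rewrite !sl2zE !mkE mE !cE /=; split; ring.
Qed.

(* If a - d is y c modulo m, swapping the diagonal entries is conjugation by
   up y, on which the two factors of psi cancel. *)
Let phi_swap k k' : ea k' = ed k -> eb k' = eb k -> ec k' = ec k -> ed k' = ea k ->
  phi k' = phi k.
Proof.
move=> aE bE cE dE.
have [/dvdzP[z zE]|ndiv] := boolP (gcdz (ec k) m %| ea k - ed k)%Z; last first.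
  by rewrite !phi_vanish // aE dE cE -rpredN opprB.
have [u [v bez]] := Bezoutz (ec k) m; rewrite -bez in zE.
pose y := z * u.
have -> : phi k' = phi (up (- y) * k * up y)%g.
  apply: phi_congr; apply/congr_sl2zP; exists (- z * v, - y * z * v, 0, z * v).
  have dk : ed k = ea k - z * (u * ec k + v * m) by rewrite -zE; ring.
  by rewrite !sl2zE !mkE aE bE cE dE dk /= /y; split; ring.
rewrite phi_up addNr; have [->|nz] := eqVneq (phi k) 0; first by rewrite mulr0.
by rewrite (psi0 nz) mul1r.
Qed.

(** A function on SL2(Z/m) that transforms under the unipotent group on both
sides by a primitive character is invariant under swapping the diagonal entries;
and twist g and g^-1 differ by that swap. *)
Lemma gelfand_symmetry g : phi (twist g) = phi (g^-1)%g.
Proof. by apply: phi_swap; rewrite !mkE !sl2zE. Qed.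
End GelfandSymmetry.

(** * Invariant inner products *)

Section Residues.
Variable n' : nat.
Let n := n'.+1.

Definition residue (x : int) : 'I_n := inord `|(x %% n)%Z|.

Lemma residue_eq x y : (residue x == residue y) = (n %| x - y)%Z.
Proof.
have bnd z : (`|(z %% n)%Z| < n)%N.
  by rewrite -ltz_nat gez0_abs ?modz_ge0 // ltz_pmod.
rewrite -eqz_mod_dvd -val_eqE /= !inordK //.
by rewrite -eqz_nat !gez0_abs ?modz_ge0.
Qed.

Definition reduction (g : SL2Z) :=
  (residue (ea g), residue (eb g), residue (ec g), residue (ed g)).

Lemma reduction_eq g h : (reduction g == reduction h) = congr_sl2z n g h.
Proof. by rewrite /reduction !xpair_eqE !residue_eq -!andbA. Qed.

Lemma reduction_mulr g g' h :
  reduction g = reduction g' -> reduction (g * h)%g = reduction (g' * h)%g.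
Proof.
by move/eqP; rewrite reduction_eq => /congr_mulr E; apply/eqP; rewrite reduction_eq.
Qed.

(** Representatives of the classes of SL2(Z) modulo n; the residues outside the
image of SL2(Z) receive an arbitrary value and are recognised by the fact that
reducing it does not give them back. *)
Lemma reduction_section : exists rep, forall g, reduction (rep (reduction g)) = reduction g.
Proof.
have /choice[rep repE] : forall M, exists h, forall g, reduction g = M -> reduction h = M.
  move=> M; have [[h hM]|no] := pselect (exists h, reduction h = M); first by exists h.
  by exists 1%g => g gM; case: no; exists g.
by exists rep => g; apply: repE erefl.
Qed.
End Residues.

Section InnerProduct.
Variables (C : numClosedFieldType) (V : vectType C).

Definition inner_product (ip : V -> V -> C) : Prop :=
  [/\ forall a x y z, ip (a *: x + y) z = a * ip x z + ip y z,
      forall x y, ip y x = (ip x y)^*,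
      forall x, 0 <= ip x x
    & forall x, ip x x = 0 -> x = 0].

Lemma exists_inner_product : exists ip, inner_product ip.
Proof.
pose c i := coord (vbasis (fullv : {vspace V})) i.
exists (fun x y => \sum_i c i x * (c i y)^*); split.
- move=> a x y z; rewrite mulr_sumr -big_split; apply: eq_bigr => i _ /=.
  by rewrite /c linearP /= mulrDl mulrA.
- move=> x y; rewrite rmorph_sum; apply: eq_bigr => i _.
  by rewrite /= rmorphM /= conjCK mulrC.
- by move=> x; apply: sumr_ge0 => i _; apply: mul_conjC_ge0.
- move=> x /eqP; rewrite psumr_eq0; last by move=> i _; apply: mul_conjC_ge0.
  move/allP=> c0; rewrite (coord_vbasis (memvf x)); apply: big1 => i _.
  have /implyP/(_ isT) := c0 i (mem_index_enum i).
  by rewrite mul_conjC_eq0 => /eqP; rewrite /c => ->; rewrite scale0r.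
Qed.

(** The injectivity of one f i makes the sum definite. *)
Lemma inner_product_sum (I : finType) (P : pred I) (f : I -> 'End(V)) i0 ip :
  inner_product ip -> P i0 -> (forall x, f i0 x = 0 -> x = 0) ->
  inner_product (fun x y => \sum_(i | P i) ip (f i x) (f i y)).
Proof.
case=> lin herm pos def Pi0 inj; split.
- move=> a x y z; rewrite mulr_sumr -big_split; apply: eq_bigr => i _ /=.
  by rewrite linearP lin.
- by move=> x y; rewrite rmorph_sum; apply: eq_bigr => i _; apply: herm.
- by move=> x; apply: sumr_ge0 => i _; apply: pos.
- move=> x /eqP; rewrite psumr_eq0 => [/allP/(_ i0 (mem_index_enum _))|//].
  by rewrite Pi0 => /eqP/def/inj.
Qed.

Variables (rho : SL2Z -> 'End(V)) (n : nat).
Hypotheses (rho_rep : is_representation rho) (n_gt0 : (0 < n)%N).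
Hypothesis rho_Gamma : forall g, Gamma n g -> rho g = \1%VF.

Lemma rho1v x : rho 1%g x = x. Proof. by case: rho_rep => -> _; rewrite id_lfunE. Qed.
Lemma rhoMv g h x : rho (g * h)%g x = rho g (rho h x).
Proof. by case: rho_rep => _ ->; rewrite comp_lfunE. Qed.
Lemma rhoKv g x : rho (g^-1)%g (rho g x) = x.
Proof. by rewrite -rhoMv mulVg rho1v. Qed.
Lemma rhoVKv g x : rho g (rho (g^-1)%g x) = x.
Proof. by rewrite -rhoMv mulgV rho1v. Qed.

Lemma rho_congr g h : congr_sl2z n g h -> rho g = rho h.
Proof.
move=> /congr_Gamma/rho_Gamma E; apply/lfunP=> x.
by rewrite -[g](mulgVK h) rhoMv E id_lfunE.
Qed.

Lemma exists_invariant_inner_product :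
  exists ip, inner_product ip /\ forall g x y, ip (rho g x) (rho g y) = ip x y.
Proof.
have [ip0 ip0P] := exists_inner_product.
case: n n_gt0 rho_congr => // n' _ rhoE.
have [rep repE] := reduction_section n'.
have rho_red g h : reduction n' g = reduction n' h -> rho g = rho h.
  by move/eqP; rewrite reduction_eq; apply: rhoE.
pose P M := reduction n' (rep M) == M.
exists (fun x y => \sum_(M | P M) ip0 (rho (rep M) x) (rho (rep M) y)); split.
  apply: (@inner_product_sum _ P (fun M => rho (rep M)) (reduction n' 1%g)) => //.
    by rewrite /P repE.
  by move=> x /= E; rewrite -(rhoKv (rep (reduction n' 1%g)) x) E linear0.
(* Right translation by h permutes the classes modulo n. *)
move=> h x y; pose mulr h M := reduction n' (rep M * h)%g.
rewrite [RHS](reindex_onto (mulr h) (mulr (h^-1)%g)) /=.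
  apply: eq_big => M; last first.
    move=> _; rewrite -!rhoMv.
    by rewrite !(rho_red (rep (mulr h M)) (rep M * h)%g) // repE.
  rewrite {2}/P repE eqxx /= /mulr /P (reduction_mulr _ (repE _)).
  by rewrite mulgK.
move=> M /eqP PM; rewrite /mulr (reduction_mulr _ (repE _)) mulgVK //.
Qed.
End InnerProduct.

(** * Spectral projections *)

Lemma exists_prim_root (C : numClosedFieldType) n :
  (0 < n)%N -> exists z : C, n.-primitive_root z.
Proof.
move=> n_gt0; have [r] := closed_field_poly_normal ('X^n - 1 : {poly C}).
rewrite (monicP (monicXnsubC 1 n_gt0)) scale1r => rE.
have /hasP[z _ z_prim] : has n.-primitive_root r.
  apply: has_prim_root => //.
  - by apply/allP=> z; rewrite -root_prod_XsubC -rE.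
  - by rewrite -separable_prod_XsubC -rE separable_Xn_sub_1 // pnatr_eq0 -lt0n.
  - by rewrite -ltnS -(size_prod_XsubC r id) -rE size_XnsubC.
by exists z.
Qed.

Section Spectral.
Variables (C : numClosedFieldType) (V : vectType C).
Variables (rho : SL2Z -> 'End(V)) (n : nat).
Hypotheses (rho_rep : is_representation rho) (n_gt0 : (0 < n)%N).
Hypothesis rho_Gamma : forall g, Gamma n g -> rho g = \1%VF.
Variable zeta : C.
Hypothesis zeta_prim : n.-primitive_root zeta.

Let zeta_n : zeta ^+ n = 1. Proof. exact: prim_expr_order. Qed.
Lemma zeta_neq0 : zeta != 0.
Proof. by apply: contraTneq (oner_neq0 C) => z0; rewrite -zeta_n z0 expr0n gtn_eqF ?eqxx. Qed.
Hint Resolve zeta_neq0 : core.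

Lemma rho_up_nat lambda x (j : nat) :
  rho sl2z_t x = lambda *: x -> rho (up j%:Z) x = lambda ^+ j *: x.
Proof.
move=> tx; elim: j => [|j IHj]; first by rewrite up0 rho1v // scale1r.
by rewrite intS upD up1 rhoMv // IHj linearZ /= tx scalerA exprSr.
Qed.

Lemma rho_up_period x : rho (up n%:Z) x = x.
Proof. by rewrite rho_Gamma ?id_lfunE //; apply: Gamma_up; apply: dvdzz. Qed.

Definition spectral_term (k : nat) (x : V) (j : nat) : V :=
  zeta ^- (j * k) *: rho (up j%:Z) x.

(** As rho(t)^n = 1, this is the projection onto the zeta^k-eigenspace of rho(t),
by Fourier inversion on Z/n. *)
Definition spectral_proj (k : nat) (x : V) : V :=
  n%:R^-1 *: \sum_(j < n) spectral_term k x j.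

Lemma spectral_term_shift k x :
  \sum_(j < n) spectral_term k x j.+1 = \sum_(j < n) spectral_term k x j.
Proof.
apply: (addrI (spectral_term k x 0)).
have -> : \sum_(j < n) spectral_term k x j.+1
   = \sum_(j < n) spectral_term k x (lift ord0 j) by [].
rewrite -(big_ord_recl n (fun j => spectral_term k x j)) big_ord_recr /= addrC.
congr (_ + _); rewrite /spectral_term mul0n exprM zeta_n expr1n up0 rho1v //.
by rewrite rho_up_period.
Qed.

Lemma spectral_proj_eigen k x :
  rho sl2z_t (spectral_proj k x) = zeta ^+ k *: spectral_proj k x.
Proof.
rewrite linearZ /= linear_sum /= scalerA mulrC -scalerA; congr (_ *: _).
rewrite -spectral_term_shift scaler_sumr; apply: eq_bigr => j _.
rewrite linearZ /= -rhoMv // -up1 -upD -intS scalerA; congr (_ *: _).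
by rewrite mulSn exprD invfM mulrA divff ?mul1r // expf_neq0.
Qed.

Lemma sum_spectral_proj x : \sum_(k < n) spectral_proj k x = x.
Proof.
rewrite -scaler_sumr exchange_big /=.
rewrite (bigD1 (Ordinal n_gt0)) //= [X in _ + X]big1 ?addr0 => [|j j_nz].
  under eq_bigr do rewrite /spectral_term mul0n invr1 scale1r up0 rho1v //.
  rewrite sumr_const card_ord -scaler_nat scalerA mulVf ?scale1r //.
  by rewrite pnatr_eq0 -lt0n.
(* a geometric sum of a nontrivial n-th root of unity vanishes *)
rewrite /spectral_term -scaler_suml; apply/eqP; rewrite scaler_eq0; apply/orP; left.
have zj : zeta ^- j - 1 != 0.
  rewrite subr_eq0 invr_eq1 -(prim_order_dvd zeta_prim) gtnNdvd //.
  by rewrite lt0n; apply: contra j_nz => /eqP j0; apply/eqP/val_inj.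
rewrite -(mulrI_eq0 _ (mulfI zj)); under eq_bigr do rewrite exprM -exprVn.
by rewrite -subrX1 exprVn exprAC zeta_n expr1n invr1 subrr.
Qed.

(** Reversing the summation over Z/n replaces zeta and t by their inverses at the
same time; hence the real structure, which inverts both, commutes with the
projection. *)
Lemma spectral_proj_neg k x :
  spectral_proj k x
    = n%:R^-1 *: \sum_(j < n) zeta ^+ (j * k) *: rho ((up j%:Z)^-1)%g x.
Proof.
congr (_ *: _); rewrite -spectral_term_shift (reindex_inj rev_ord_inj) /=.
apply: eq_bigr => j _; rewrite /spectral_term -subSn // subSS.
rewrite -subzn ?(ltnW (ltn_ord j)) // upD rhoMv // -upN; congr (_ *: _); last first.
  by rewrite -[in RHS](rho_up_period x) -!rhoMv // -!upD addrC.
apply: (mulIf (expf_neq0 ((n - j) * k) zeta_neq0)).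
rewrite mulVf ?expf_neq0 // -exprD -mulnDl subnKC ?exprM ?zeta_n ?expr1n //.
exact: ltnW.
Qed.

End Spectral.

(** * Orthonormal families for an invariant inner product *)

(** Families of bounded size can be extended greedily until none of the extensions
is admissible; used for orthonormal families. *)
Lemma exists_maximal (T : Type) (P : seq T -> Prop) d :
  P [::] -> (forall s, P s -> (size s <= d)%N) ->
  exists s, P s /\ forall u, ~ P (u :: s).
Proof.
move=> P0 Pd; pose Q k := `[< exists s, P s /\ size s = k >].
have exQ : exists k, Q k by exists 0; apply/asboolP; exists [::].
have Qd k : Q k -> (k <= d)%N by move=> /asboolP[s [Ps <-]]; apply: Pd.
case: (ex_maxnP exQ Qd) => k /asboolP[s [Ps sk]] k_max.
exists s; split=> // u Pus.
have /k_max : Q (size (u :: s)) by apply/asboolP; exists (u :: s).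
by rewrite /= sk ltnn.
Qed.

Section CongruenceRepresentation.
Variables (C : numClosedFieldType) (V : vectType C).
Variables (rho : SL2Z -> 'End(V)) (n : nat).
Hypotheses (rho_rep : is_representation rho) (n_gt0 : (0 < n)%N).
Hypothesis rho_Gamma : forall g, Gamma n g -> rho g = \1%VF.
Variable zeta : C.
Hypothesis zeta_prim : n.-primitive_root zeta.
Variable ip : V -> V -> C.
Hypothesis ipP : inner_product ip.
Hypothesis ip_rho : forall g x y, ip (rho g x) (rho g y) = ip x y.

Lemma ipZl a x y : ip (a *: x) y = a * ip x y.
Proof.
have [lin _ _ _] := ipP; have ip0 z : ip 0 z = 0.
  by apply: (addrI (ip 0 z)); rewrite addr0 -{1}[ip 0 z]mul1r -lin scale1r addr0.
by rewrite -[a *: x]addr0 lin ip0 addr0.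
Qed.
Lemma ipDl x y z : ip (x + y) z = ip x z + ip y z.
Proof. by have [lin _ _ _] := ipP; rewrite -{1}[x]scale1r lin mul1r. Qed.
Lemma ipC x y : ip y x = (ip x y)^*.
Proof. by have [_ herm _ _] := ipP. Qed.
Lemma ipZr a x y : ip x (a *: y) = a^* * ip x y.
Proof. by rewrite ipC ipZl rmorphM /= -ipC. Qed.
Lemma ipDr x y z : ip x (y + z) = ip x y + ip x z.
Proof. by rewrite ipC ipDl rmorphD /= -!ipC. Qed.
Lemma ip0l x : ip 0 x = 0. Proof. by rewrite -(scale0r 0) ipZl mul0r. Qed.
Lemma ip0r x : ip x 0 = 0. Proof. by rewrite ipC ip0l rmorph0. Qed.
Lemma ip_eq0 x : (ip x x == 0) = (x == 0).
Proof.
have [_ _ _ def] := ipP; apply/eqP/eqP => [/def //|->]; exact: ip0l.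
Qed.
Lemma ip_sumr (I : Type) (r : seq I) (P : pred I) (f : I -> V) x :
  ip x (\sum_(i <- r | P i) f i) = \sum_(i <- r | P i) ip x (f i).
Proof. by elim/big_rec2: _ => [|i y z _ <-]; rewrite ?ip0r ?ipDr. Qed.
Lemma ip_suml (I : Type) (r : seq I) (P : pred I) (f : I -> V) x :
  ip (\sum_(i <- r | P i) f i) x = \sum_(i <- r | P i) ip (f i) x.
Proof. by elim/big_rec2: _ => [|i y z _ <-]; rewrite ?ip0l ?ipDl. Qed.
Lemma ip_rhoV g x y : ip (rho g x) y = ip x (rho (g^-1)%g y).
Proof. by rewrite -[y in LHS](rhoVKv rho_rep g) ip_rho. Qed.
Lemma ip_rhoVr g x y : ip x (rho g y) = ip (rho (g^-1)%g x) y.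
Proof. by rewrite ip_rhoV invgK. Qed.

Fixpoint orthonormal (s : seq V) : Prop :=
  if s is u :: s' then
    [/\ ip u u = 1, {in s', forall x, ip x u = 0} & orthonormal s']
  else True.

Lemma orthonormal_nth s i j : orthonormal s -> (i < size s)%N -> (j < size s)%N ->
  ip s`_i s`_j = (i == j)%:R.
Proof.
elim: s i j => //= u s IHs [|i] [|j] [uu us os] //= si sj.
- by rewrite ipC us ?rmorph0 // mem_nth.
- by rewrite us // mem_nth.
- exact: IHs.
Qed.

Lemma orthonormal_in s x : orthonormal s -> x \in s -> ip x x = 1.
Proof. by move=> os /(nthP 0)[i si <-]; rewrite orthonormal_nth // eqxx. Qed.

Lemma orthonormal_size s : orthonormal s -> (size s <= \dim {:V})%N.
Proof.
move=> os; suff /eqP<- : free s by apply/dimvS/subvf.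
elim: s os => [_|u s IHs [uu us os]]; first exact: nil_free.
rewrite free_cons IHs // andbT; apply/negP => us_span.
case/negP: (oner_neq0 C); rewrite -uu.
move: us_span; rewrite -[s]/(val (in_tuple s)) => /coord_span {1}->.
rewrite ip_suml big1 // => i _; rewrite ipZl us ?mulr0 //.
exact: mem_nth.
Qed.

Lemma normalize v : v != 0 ->
  exists c : C, [/\ c != 0, c^* = c & ip (c *: v) (c *: v) = 1].
Proof.
move=> nz; have [_ _ pos _] := ipP.
have sq_nz : sqrtC (ip v v) != 0 by rewrite sqrtC_eq0 ip_eq0.
have sq_real : (sqrtC (ip v v))^* = sqrtC (ip v v).
  by apply/CrealP; rewrite ger0_real // sqrtC_ge0.
exists (sqrtC (ip v v))^-1; split; rewrite ?invr_eq0 //.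
  by rewrite fmorphV /= sq_real.
rewrite ipZl ipZr fmorphV /= sq_real mulrA -invfM -expr2 sqrtCK mulVf //.
by rewrite ip_eq0.
Qed.

(** * Vectors with a primitive eigenvalue *)

Definition fixed_by_Gamma (m : nat) (v : V) : Prop :=
  forall g, Gamma m g -> rho g v = v.

Lemma fixed_congr (m : nat) v g h :
  fixed_by_Gamma m v -> congr_sl2z m g h -> rho g v = rho h v.
Proof.
move=> fv /congr_Gamma/(Gamma_conj (h^-1)%g)/fv E.
by rewrite -{2}E -!rhoMv // invgK -[in RHS]mulgA mulgVK mulVKg.
Qed.

Lemma fixed_stable (m : nat) v g : fixed_by_Gamma m v -> fixed_by_Gamma m (rho g v).
Proof.
move=> fv h /(Gamma_conj (g^-1)%g)/fv E.
by rewrite -{2}E -!rhoMv // invgK -[in RHS]mulgA mulVKg.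
Qed.

Definition subrepresentation (U : V -> Prop) : Prop :=
  (forall a x y, U x -> U y -> U (a *: x + y)) /\ (forall g x, U x -> U (rho g x)).

Section Minimal.
Variables (U : V -> Prop) (m : nat).
Hypotheses (U_sub : subrepresentation U) (m_gt0 : (0 < m)%N).
Hypothesis m_min : forall k v, (0 < k < m)%N -> U v -> fixed_by_Gamma k v -> v = 0.

Let spectral_stable (W : V -> Prop) k x :
  (forall a y z, W y -> W z -> W (a *: y + z)) ->
  (forall j : nat, forall y, W y -> W (rho (up j%:Z) y)) ->
  W x -> W (spectral_proj rho n zeta k x).
Proof.
move=> W_lin W_up Wx; have W0 : W 0 by rewrite -(addNr x) -scaleN1r; apply: (W_lin).
rewrite /spectral_proj -[X in W X]addr0; apply: (W_lin) => //.
elim/big_ind: _ => // [y z Wy Wz|j _]; first by rewrite -[y]scale1r; apply: W_lin.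
by rewrite /spectral_term -[X in W X]addr0; apply: W_lin => //; apply: W_up.
Qed.

(** The primes in S are handled by induction.  Given an eigenvector v of t whose
eigenvalue is nontrivial on t^(m/p) for p in S, and a new prime q, let W be the
space of vectors on which each t^(m/p) acts as it does on v.  The q-part of
SL2(Z/m) preserves W, so if t^(m/q) were trivial on W, then v would be fixed by
Gamma (m / q), against the minimality of m.  Hence t has an eigenvector in W
whose eigenvalue is nontrivial on t^(m/q). *)
Lemma exists_partially_primitive (S : seq nat) v0 :
  U v0 -> fixed_by_Gamma m v0 -> v0 != 0 ->
  uniq S -> {in S, forall p, prime p && (p %| m)%N} ->
  exists v lambda, [/\ U v, fixed_by_Gamma m v, v != 0,
    rho sl2z_t v = lambda *: v & {in S, forall p, lambda ^+ (m %/ p) != 1}].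
Proof.
have [U_lin U_rho] := U_sub; move=> Uv0 fv0 nz0.
have fix_lin a x y : fixed_by_Gamma m x -> fixed_by_Gamma m y ->
    fixed_by_Gamma m (a *: x + y).
  by move=> fx fy g Gg; rewrite linearP /= fx // fy.
elim: S => [_ _|q S IHS /=/andP[q_nS S_uniq] qS_prime].
  have [k nzk] : exists k : nat, spectral_proj rho n zeta k v0 != 0.
    apply/not_existsP => z; case/eqP: nz0.
    rewrite -(sum_spectral_proj rho_rep n_gt0 zeta_prim v0) big1 // => k _.
    by apply/eqP; apply: contraT => nz; case: (z k).
  exists (spectral_proj rho n zeta k v0), (zeta ^+ k); split=> //.
  - by apply: (spectral_stable (W := U)) => // j y; apply: U_rho.
  - by apply: (spectral_stable (W := fixed_by_Gamma m)) => // j y; apply: fixed_stable.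
  - exact: (spectral_proj_eigen rho_rep n_gt0 rho_Gamma zeta_prim).
have /andP[pr_q q_m] := qS_prime q (mem_head q S).
have S_prime p : p \in S -> prime p && (p %| m)%N.
  by move=> pS; apply: qS_prime; rewrite inE pS orbT.
have [v [lambda [Uv fv nzv tv lamS]]] := IHS S_uniq S_prime.
pose W w := [/\ U w, fixed_by_Gamma m w &
  {in S, forall p, rho (up (m %/ p)%N) w = lambda ^+ (m %/ p) *: w}].
have Wv : W v by split=> // p pS; apply: rho_up_nat.
have W_lin a y z : W y -> W z -> W (a *: y + z).
  case=> Uy fy yS [Uz fz zS]; split; [exact: U_lin|exact: fix_lin|].
  by move=> p pS; rewrite linearP /= yS // zS // scalerDr !scalerA mulrC.
have W_Gamma h w : Gamma m`_q^' h -> W w -> W (rho h w).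
  move=> Gh [Uw fw wS]; split; [exact: U_rho|exact: fixed_stable|] => p pS.
  have /andP[pr_p p_m] := S_prime p pS.
  transitivity (rho h (rho (up (m %/ p)%N) w)); last by rewrite wS // linearZ.
  rewrite -!rhoMv //; apply: (fixed_congr fw).
  by apply: (congr_up_commute (q := q)) => //; apply: contraNneq q_nS => <-.
have W_up (j : nat) w : W w -> W (rho (up j%:Z) w).
  case=> Uw fw wS; split; [exact: U_rho|exact: fixed_stable|] => p pS.
  transitivity (rho (up j%:Z) (rho (up (m %/ p)%N) w)); last by rewrite wS // linearZ.
  by rewrite -!rhoMv // -!upD addrC.
have [trivial|] := pselect (forall w, W w -> rho (up (m %/ q)%N) w = w).
  case/eqP: nzv; apply: (m_min (k := m %/ q)) => //.
    by rewrite divn_gt0 ?prime_gt0 // dvdn_leq //= ltn_Pdiv // prime_gt1.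
  move=> g Gg; pose N g := forall w, W w -> rho g w = w.
  apply: (@Gamma_generated N m q) => //.
  - by move=> x y Nx Ny w Ww; rewrite rhoMv // Ny // Nx.
  - by move=> x Nx w Ww; rewrite -{1}(Nx w Ww) rhoKv.
  - by move=> x Gx w [_ fw _]; apply: fw.
  - move=> x h Gh Nx w Ww; rewrite !rhoMv // Nx ?rhoVKv //.
    by apply: W_Gamma => //; apply: GammaV.
move=> /existsNP[w /not_implyP[Ww w_moved]].
have [k [nzk zk]] : exists k : nat,
    spectral_proj rho n zeta k w != 0 /\ zeta ^+ k ^+ (m %/ q) != 1.
  apply/not_existsP => z; apply: w_moved.
  rewrite -(sum_spectral_proj rho_rep n_gt0 zeta_prim w) linear_sum.
  apply: eq_bigr => k _ /=.
  rewrite (rho_up_nat rho_rep _ (spectral_proj_eigen rho_rep n_gt0 rho_Gamma zeta_prim k w)).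
  have [->|nzk] := eqVneq (spectral_proj rho n zeta k w) 0; first by rewrite scaler0.
  have [->|zk] := eqVneq (zeta ^+ k ^+ (m %/ q)) 1; first by rewrite scale1r.
  by case: (z k).
have tw := spectral_proj_eigen rho_rep n_gt0 rho_Gamma zeta_prim k w.
have [Uw' fw' wS'] : W (spectral_proj rho n zeta k w) by apply: spectral_stable.
exists (spectral_proj rho n zeta k w), (zeta ^+ k); split=> // p.
rewrite inE => /predU1P[->//|pS].
suff -> : zeta ^+ k ^+ (m %/ p) = lambda ^+ (m %/ p) by apply: lamS.
apply/eqP; rewrite -subr_eq0.
have /eqP := wS' p pS; rewrite (rho_up_nat rho_rep _ tw) -subr_eq0 -scalerBl.
by rewrite scaler_eq0 (negPf nzk) orbF.
Qed.

End Minimal.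

(** With m minimal, an eigenvalue lambda with lambda^(m/p) <> 1 for every prime p
dividing m has order exactly m. *)
Lemma exists_primitive_vector (U : V -> Prop) v0 :
  subrepresentation U -> U v0 -> v0 != 0 ->
  exists m lambda v, [/\ m.-primitive_root lambda, U v, v != 0,
    rho sl2z_t v = lambda *: v & fixed_by_Gamma m v].
Proof.
move=> U_sub Uv0 nz0.
pose P m := `[< (0 < m)%N /\ exists v, [/\ U v, v != 0 & fixed_by_Gamma m v] >].
have exP : exists m, P m.
  exists n; apply/asboolP; split=> //; exists v0; split=> // g /rho_Gamma->.
  by rewrite id_lfunE.
case: (ex_minnP exP) => m /asboolP[m_gt0 [v1 [Uv1 nz1 fv1]]] m_min.
have m_minimal k v : (0 < k < m)%N -> U v -> fixed_by_Gamma k v -> v = 0.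
  move=> /andP[k_gt0 k_lt_m] Uv fv; apply/eqP; apply: contraLR k_lt_m => nz.
  by rewrite -leqNgt; apply/m_min/asboolP; split=> //; exists v.
have [|v [lambda [Uv fv nz tv lamP]]] := exists_partially_primitive U_sub m_gt0
    m_minimal Uv1 fv1 nz1 (primes_uniq m).
  by move=> p; rewrite mem_primes => /and3P[-> _ ->].
exists m, lambda, v; split=> //.
have lam_m : lambda ^+ m = 1.
  have := rho_up_nat rho_rep m tv.
  rewrite fv => [/eqP|]; last exact/Gamma_up/dvdzz.
  rewrite -{1}[v]scale1r eq_sym -subr_eq0 -scalerBl scaler_eq0 (negPf nz) orbF.
  by rewrite subr_eq0 => /eqP.
have [k k_prim k_dvd] := prim_order_exists m_gt0 lam_m.
have [<-//|k_neq_m] := eqVneq k m.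
have k_gt0 := prim_order_gt0 k_prim.
have mk_gt1 : (1 < m %/ k)%N.
  by rewrite ltn_neqAle divn_gt0 // dvdn_leq // andbT eqn_div // mul1n.
have q_mk := pdiv_dvd (m %/ k); have pr_q := pdiv_prime mk_gt1.
have q_m : (pdiv (m %/ k) %| m)%N by apply: dvdn_trans q_mk (dvdn_div k_dvd).
have /negP[] : lambda ^+ (m %/ pdiv (m %/ k)) != 1.
  by apply: lamP; rewrite mem_primes pr_q m_gt0.
rewrite -(prim_order_dvd k_prim); case/dvdnP: q_mk => r.
move: (pdiv _) pr_q => p pr_p rE.
rewrite -{1}(divnK k_dvd) rE mulnAC mulnK ?prime_gt0 // dvdn_mull //.
Qed.

Lemma rho_up_int lambda v (x : int) : lambda != 0 ->
  rho sl2z_t v = lambda *: v -> rho (up x) v = lambda ^ x *: v.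
Proof.
move=> nz tv; case: x => j; first exact: rho_up_nat.
rewrite NegzE upN -exprnN -[in LHS](scale1r v).
rewrite -(mulVf (expf_neq0 j.+1 nz)) -scalerA -(rho_up_nat rho_rep j.+1 tv).
by rewrite linearZ /= rhoKv.
Qed.

(** This is gelfand_symmetry for the matrix coefficient of v, together with
<rho(g^-1) v, v> = conj <rho(g) v, v>. *)
Lemma primitive_vector_twist m lambda v g :
  m.-primitive_root lambda -> v != 0 -> rho sl2z_t v = lambda *: v ->
  fixed_by_Gamma m v -> ip (rho (twist g) v) v = (ip (rho g v) v)^*.
Proof.
move=> lam_prim nz tv fv.
have lam_conj : lambda * lambda^* = 1.
  have := ip_rho sl2z_t v v; rewrite tv ipZl ipZr mulrA => E.
  by apply: (mulIf (x := ip v v)); rewrite ?ip_eq0 // mul1r.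
have lam_nz : lambda != 0.
  by apply: contra_eq_neq lam_conj => ->; rewrite mul0r eq_sym oner_neq0.
have phi_congr g1 g2 : congr_sl2z m g1 g2 -> ip (rho g1 v) v = ip (rho g2 v) v.
  by move=> E; rewrite (fixed_congr fv E).
have phi_up x y g1 : ip (rho (up x * g1 * up y)%g v) v
    = lambda ^ (x + y) * ip (rho g1 v) v.
  rewrite !rhoMv // (rho_up_int _ lam_nz tv) !linearZ /= ipZl ip_rhoV -upN.
  rewrite (rho_up_int _ lam_nz tv) ipZr mulrA; congr (_ * _).
  rewrite expfzDr // mulrC; congr (_ * _).
  have lamV : lambda^* = lambda^-1.
    by apply: (mulfI lam_nz); rewrite lam_conj mulfV.
  by rewrite fmorphXz /= lamV exprz_inv opprK.
rewrite -ipC -[in RHS](invgK g) -ip_rhoV.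
have := @gelfand_symmetry C m (fun x => lambda ^ x) (fun h => ip (rho h v) v)
  _ _ phi_congr phi_up g.
apply; first exact: prim_order_gt0 lam_prim.
case=> k; first by move/eqP; rewrite -(prim_order_dvd lam_prim).
by move/eqP; rewrite NegzE -exprnN invr_eq1 -(prim_order_dvd lam_prim).
Qed.

(** * A complete family of cyclic vectors with real Gram functions *)

(** Precisely the condition under which
rho(g) v |-> rho(twist g) v, for v in vs, preserves inner products up to complex
conjugation, hence extends to an antiunitary map. *)
Definition twist_compatible (vs : seq V) : Prop :=
  forall v w g, v \in vs -> w \in vs ->
    ip (rho (twist g) v) w = (ip (rho g v) w)^*.

(** In a maximal family the vectors orthogonal to all orbits form a
subrepresentation; a primitive vector in it would extend the family, as the
mixed inner products vanish. *)
Lemma exists_cyclic_family : exists vs, twist_compatible vs /\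
  forall u, (forall v g, v \in vs -> ip u (rho g v) = 0) -> u = 0.
Proof.
pose P s := orthonormal s /\ twist_compatible s.
have [|s []|vs [[vs_orth vs_tw] vs_max]] := exists_maximal (P := P) (d := \dim {:V}).
- by split.
- by move=> /orthonormal_size.
exists vs; split=> // u u_perp; apply/eqP; apply: contraT => u_nz.
pose U x := forall v g, v \in vs -> ip x (rho g v) = 0.
have U_sub : subrepresentation U.
  split=> [a x y Ux Uy v g vvs|h x Ux v g vvs].
    by rewrite ipDl ipZl Ux // Uy // mulr0 addr0.
  by rewrite ip_rhoV -rhoMv // Ux.
have [m [lambda [v [lam_prim Uv v_nz tv fv]]]] :=
  exists_primitive_vector U_sub u_perp u_nz.
have [c [c_nz _ norm1]] := normalize v_nz.
have Ucv g w : w \in vs -> ip (c *: v) (rho g w) = 0.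
  by move=> wvs; rewrite ipZl Uv // mulr0.
case: (vs_max (c *: v)); split=> [|x y g].
  by split=> // x xvs; rewrite ipC -[x](rho1v rho_rep) Ucv ?rmorph0.
rewrite !inE => /predU1P[->|xvs] /predU1P[->|yvs].
- apply: primitive_vector_twist lam_prim _ _ _.
  + by rewrite scaler_eq0 negb_or c_nz.
  + by rewrite linearZ /= tv !scalerA mulrC.
  + by move=> h Gh; rewrite linearZ /= fv.
- by rewrite !ip_rhoV !Ucv // rmorph0.
- by rewrite ipC [X in _ = X^*]ipC !Ucv // !rmorph0.
- exact: vs_tw.
Qed.

(** * The real structure *)

Section RealStructure.
Variable vs : seq V.
Hypothesis vs_compatible : twist_compatible vs.

(** The graph of the real structure J, generated along the presentations of a
vector as a combination of the rho(g) v with v in vs. *)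
Inductive conj_rel : V -> V -> Prop :=
| conj_rel0 : conj_rel 0 0
| conj_relS c g v x y : v \in vs -> conj_rel x y ->
    conj_rel (c *: rho g v + x) (c^* *: rho (twist g) v + y).

Lemma conj_rel_gen v g : v \in vs -> conj_rel (rho g v) (rho (twist g) v).
Proof.
move=> vvs; have := conj_relS 1 g vvs conj_rel0.
by rewrite rmorph1 !scale1r !addr0.
Qed.

Lemma conj_relD x y x' y' :
  conj_rel x y -> conj_rel x' y' -> conj_rel (x + x') (y + y').
Proof.
move=> xy xy'; elim: xy => [|c g v x0 y0 vvs _ IH]; first by rewrite !add0r.
by rewrite -!addrA; apply: conj_relS.
Qed.

Lemma conj_relZ a x y : conj_rel x y -> conj_rel (a *: x) (a^* *: y).
Proof.
elim=> [|c g v x0 y0 vvs _ IH]; first by rewrite !scaler0; apply: conj_rel0.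
by rewrite !scalerDr !scalerA -rmorphM; apply: conj_relS.
Qed.

Lemma conj_rel_sym x y : conj_rel x y -> conj_rel y x.
Proof.
elim=> [|c g v x0 y0 vvs _ IH]; first exact: conj_rel0.
by have := conj_relS c^* (twist g) vvs IH; rewrite conjCK twistK.
Qed.

Lemma conj_rel_rho h x y : conj_rel x y -> conj_rel (rho h x) (rho (twist h) y).
Proof.
elim=> [|c g v x0 y0 vvs _ IH]; first by rewrite !linear0; apply: conj_rel0.
by rewrite !linearP /= -!rhoMv // -twistM; apply: conj_relS.
Qed.

(** J is antiunitary.  In particular inner products of J-fixed vectors are real,
which is what keeps the Gram-Schmidt process inside the J-fixed vectors. *)
Lemma conj_rel_ip x y x' y' :
  conj_rel x y -> conj_rel x' y' -> ip y y' = (ip x x')^*.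
Proof.
move=> xy xy'.
have gen v g : v \in vs -> ip (rho (twist g) v) y' = (ip (rho g v) x')^*.
  move=> vvs; elim: xy' => [|c h w x0 y0 wvs _ IH]; first by rewrite !ip0r rmorph0.
  rewrite !ipDr !ipZr rmorphD /= rmorphM /= IH; congr (_ * _ + _).
  by rewrite !ip_rhoVr -twistV -!rhoMv // -twistM vs_compatible.
elim: xy => [|c g v x0 y0 vvs _ IH]; first by rewrite !ip0l rmorph0.
by rewrite !ipDl !ipZl rmorphD /= rmorphM /= IH gen.
Qed.

Lemma conj_rel_sum (I : Type) (r : seq I) (P : pred I) (f f' : I -> V) :
  (forall i, P i -> conj_rel (f i) (f' i)) ->
  conj_rel (\sum_(i <- r | P i) f i) (\sum_(i <- r | P i) f' i).
Proof. by move=> ff'; apply: big_ind2; [exact: conj_rel0|exact: conj_relD|]. Qed.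

Lemma zeta_conj : zeta^* = zeta^-1.
Proof.
have norm1 : `|zeta| = 1.
  apply/eqP; rewrite -(@pexpr_eq1 _ _ n) //.
  by rewrite -normrX (prim_expr_order zeta_prim) normr1.
by rewrite invC_norm norm1 expr1n invr1 mul1r.
Qed.

Lemma conj_rel_spectral k x :
  conj_rel x x -> conj_rel (spectral_proj rho n zeta k x) (spectral_proj rho n zeta k x).
Proof.
move=> xx; rewrite [X in conj_rel _ X](spectral_proj_neg rho_rep n_gt0 rho_Gamma zeta_prim).
rewrite -[n%:R^-1 in X in conj_rel _ X](_ : (n%:R^-1)^* = _ :> C); last first.
  by rewrite fmorphV /= rmorph_nat.
apply: conj_relZ; apply: conj_rel_sum => j _.
have := conj_relZ (zeta ^- (j * k)) (conj_rel_rho (up j%:Z) xx).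
by rewrite fmorphV rmorphXn /= zeta_conj exprVn invrK twist_up.
Qed.

Definition real_eigenfamily (b : seq V) : Prop := orthonormal b /\
  forall x, x \in b -> conj_rel x x /\ exists mu, rho sl2z_t x = mu *: x.

(** The line of a t-eigenvector y is stable under rho(t), so its orthogonal
complement is too, and contains the spectral projections of its elements. *)
Lemma spectral_proj_perp k x y mu : ip x y = 0 -> y != 0 ->
  rho sl2z_t y = mu *: y -> ip (spectral_proj rho n zeta k x) y = 0.
Proof.
move=> xy y_nz ty; have mu_nz : mu != 0.
  apply: contraNneq y_nz => mu0.
  by rewrite -(rhoKv rho_rep sl2z_t y) ty mu0 scale0r linear0.
rewrite ipZl ip_suml big1 ?mulr0 // => j _.
by rewrite ipZl ip_rhoV -upN (rho_up_int _ mu_nz ty) ipZr xy !mulr0.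
Qed.

Hypothesis vs_complete : forall u, (forall v g, v \in vs -> ip u (rho g v) = 0) -> u = 0.

(** Each z in the space generated by vs is a combination of the J-fixed vectors
z + J z and i (z - J z). *)
Lemma exists_real_nonperp u : u != 0 -> exists x, conj_rel x x /\ ip u x != 0.
Proof.
move=> u_nz; have [v [g [vvs uz]]] : exists v g, v \in vs /\ ip u (rho g v) != 0.
  apply/not_existsP => no; case/eqP: u_nz; apply: vs_complete => v g vvs.
  by apply/eqP; apply: contraT => uz; case: (no v); exists g.
pose z := rho g v; pose z' := rho (twist g) v.
have zz' : conj_rel z z' by apply: conj_rel_gen.
have [E1|nz1] := eqVneq (ip u (z + z')) 0; last first.
  exists (z + z'); split=> //; rewrite {2}addrC; apply: conj_relD => //.
  exact: conj_rel_sym.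
exists ('i *: (z - z')); split.
  have := conj_relZ 'i (conj_relD zz' (conj_relZ (-1) (conj_rel_sym zz'))).
  rewrite rmorphN1 !scaleN1r conjCi scaleNr -scalerN opprB addrC.
  by rewrite [X in conj_rel _ ('i *: X)]addrC [X in conj_rel ('i *: X)]addrC.
rewrite ipZr mulf_neq0 ?conjC_eq0 ?neq0Ci //.
apply: contra uz => /eqP E2; rewrite -/z.
have : ip u (z + z') + ip u (z - z') = 0 by rewrite E1 E2 addr0.
rewrite -ipDr addrACA subrr addr0 -mulr2n -scaler_nat ipZr => /eqP.
by rewrite mulf_eq0 conjC_eq0 pnatr_eq0.
Qed.

(** If u is orthogonal to a maximal family b, take a J-fixed x with <u, x> <> 0.
Subtracting its projection to the span of b keeps it J-fixed and nonzero, and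
one of its spectral projections is a nonzero J-fixed t-eigenvector orthogonal to
b, which could be added to b after normalisation by a real scalar. *)
Lemma exists_real_eigenfamily : exists b, real_eigenfamily b /\
  forall u, (forall x, x \in b -> ip u x = 0) -> u = 0.
Proof.
have [|s []|b [[b_orth b_real] b_max]] :=
  exists_maximal (P := real_eigenfamily) (d := \dim {:V}).
- by split.
- by move=> /orthonormal_size.
exists b; split=> // u u_perp; apply/eqP; apply: contraT => u_nz.
have [x [x_real ux]] := exists_real_nonperp u_nz.
pose x' := x + (-1) *: \sum_(y <- b) ip x y *: y.
have x'_real : conj_rel x' x'.
  apply: conj_relD => //; rewrite -{2}(rmorphN1 Num.conj); apply: conj_relZ.
  rewrite !big_seq; apply: conj_rel_sum => y yb.
  have [y_real _] := b_real y yb.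
  by rewrite {2}(conj_rel_ip x_real y_real); apply: conj_relZ.
have ux' : ip u x' != 0.
  rewrite ipDr ipZr ip_sumr big_seq big1 ?mulr0 ?addr0 // => y yb.
  by rewrite ipZr u_perp // mulr0.
have x'_perp y : y \in b -> ip x' y = 0.
  move=> /(nthP 0)[i ib <-].
  rewrite ipDl ipZl ip_suml (big_nth 0) big_mkord (bigD1 (Ordinal ib)) //=.
  rewrite ipZl orthonormal_nth // eqxx mulr1 big1 ?addr0 ?mulN1r ?subrr // => j ji.
  by rewrite ipZl orthonormal_nth // (negPf (ji : (j : nat) != i)) mulr0.
have [k k_nz] : exists k : nat, spectral_proj rho n zeta k x' != 0.
  apply/not_existsP => no; case/eqP: ux'.
  rewrite -(sum_spectral_proj rho_rep n_gt0 zeta_prim x') big1 ?ip0r // => k _.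
  by apply/eqP; apply: contraT => nz; case: (no k).
have [c [c_nz c_real norm1]] := normalize k_nz.
case: (b_max (c *: spectral_proj rho n zeta k x')); split.
  split=> // y yb; have [_ [mu ty]] := b_real y yb.
  rewrite ipC ipZl (spectral_proj_perp _ (x'_perp y yb) _ ty) ?mulr0 ?rmorph0 //.
  by rewrite -ip_eq0 (orthonormal_in b_orth yb) oner_neq0.
move=> y; rewrite inE => /predU1P[->|/b_real//]; split.
  by rewrite -{2}c_real; apply/conj_relZ/conj_rel_spectral.
exists (zeta ^+ k).
rewrite linearZ /= (spectral_proj_eigen rho_rep n_gt0 rho_Gamma zeta_prim).
by rewrite [LHS]scalerA mulrC -scalerA.
Qed.

End RealStructure.

(** * The symmetric matrix form *)

Section MatrixForm.
Variables (vs b : seq V).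
Hypotheses (vs_compatible : twist_compatible vs) (b_eigen : real_eigenfamily vs b).
Hypothesis b_complete : forall u, (forall x, x \in b -> ip u x = 0) -> u = 0.
Let N := size b.

Let b_ip (i j : 'I_N) : ip b`_i b`_j = (i == j)%:R.
Proof. by have [b_orth _] := b_eigen; rewrite orthonormal_nth. Qed.

Lemma orthonormal_expansion v : v = \sum_(i < N) ip v b`_i *: b`_i.
Proof.
apply/eqP; rewrite -subr_eq0 -scaleN1r; apply/eqP/b_complete => x /(nthP 0)[j jb <-].
rewrite ipDl ipZl ip_suml (bigD1 (Ordinal jb)) //= ipZl (b_ip (Ordinal jb) (Ordinal jb)).
rewrite eqxx mulr1 big1 ?addr0 ?mulN1r ?subrr // => i ij.
by rewrite ipZl (b_ip i (Ordinal jb)) (negPf ij) mulr0.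
Qed.

Definition basis_matrix (g : SL2Z) : 'M[C]_N :=
  \matrix_(i, j) ip (rho g b`_j) b`_i.

Lemma basis_matrix1 : basis_matrix 1%g = 1%:M.
Proof. by apply/matrixP => i j; rewrite !mxE rho1v // b_ip eq_sym. Qed.

Lemma basis_matrix_vector g v :
  \col_i ip (rho g v) b`_i = basis_matrix g *m \col_i ip v b`_i.
Proof.
apply/colP => i; rewrite !mxE {1}(orthonormal_expansion v) linear_sum ip_suml.
by apply: eq_bigr => j _; rewrite !mxE linearZ ipZl mulrC.
Qed.

Lemma basis_matrixM g h : basis_matrix (g * h)%g = basis_matrix g *m basis_matrix h.
Proof.
apply/matrixP => i j.
have /colP/(_ i) := basis_matrix_vector g (rho h b`_j).
by rewrite !mxE rhoMv // => ->; apply: eq_bigr => k _; rewrite !mxE.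
Qed.

Lemma basis_matrix_unitary g : basis_matrix g \is unitarymx.
Proof.
apply/unitarymxP; rewrite -basis_matrix1 -(mulgV g) basis_matrixM; congr (_ *m _).
by apply/matrixP => i j; rewrite !mxE -ipC ip_rhoVr.
Qed.

Lemma basis_matrix_t_diag : is_diag_mx (basis_matrix sl2z_t).
Proof.
apply/is_diag_mxP => i j ij; rewrite mxE.
have [_ /(_ b`_j (mem_nth 0 (ltn_ord j)))[_ [mu ->]]] := b_eigen.
by rewrite ipZl b_ip eq_sym (negPf (ij : i != j)) mulr0.
Qed.

(** As J exchanges rho(s) x and rho(s^-1) x for J-fixed x, one has
<rho(s^-1) b_j, b_i> = conj <rho(s) b_j, b_i>, while unitarity turns the left
side into conj <rho(s) b_i, b_j>. *)
Lemma basis_matrix_s_sym : (basis_matrix sl2z_s)^T = basis_matrix sl2z_s.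
Proof.
apply/matrixP => i j; rewrite !mxE.
have b_real (k : 'I_N) : conj_rel vs b`_k b`_k.
  by have [_ /(_ _ (mem_nth 0 (ltn_ord k)))[]] := b_eigen.
apply: (can_inj (@conjCK C)); rewrite -ipC ip_rhoVr.
by rewrite -twist_s (conj_rel_ip vs_compatible (conj_rel_rho _ (b_real j)) (b_real i)).
Qed.

Lemma equivalent_to_basis_matrix : equivalent_to_mx rho basis_matrix.
Proof.
pose f v : 'cV[C]_N := \col_i ip v b`_i.
have f_lin : linear f.
  by move=> a x y; apply/colP => i; rewrite !mxE ipDl ipZl.
pose fL := HB.pack_for {linear V -> 'cV[C]_N} f (GRing.isLinear.Build _ _ _ _ f f_lin).
exists (linfun fL); split; last first.
  by move=> g v; rewrite !lfunE /=; apply: basis_matrix_vector.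
exists (fun c : 'cV[C]_N => \sum_(i < N) c i 0 *: b`_i) => [v|c]; rewrite lfunE /= /f.
  by rewrite [RHS]orthonormal_expansion; apply: eq_bigr => i _; rewrite mxE.
apply/colP => i; rewrite mxE ip_suml (bigD1 i) //= ipZl b_ip eqxx mulr1.
by rewrite big1 ?addr0 // => j ji; rewrite ipZl b_ip (negPf ji) mulr0.
Qed.

End MatrixForm.
End CongruenceRepresentation.

Local Open Scope complex_scope.

Theorem theorem2p10 (R : realType) (V : vectType R[i]) (rho : SL2Z -> 'End(V)) :
  is_representation rho -> congruence rho -> symmetrizable rho.
Proof.
move=> rho_rep [n [n_gt0 rho_Gamma _]].
have [zeta zeta_prim] := exists_prim_root R[i] n_gt0.
have [ip [ipP ip_rho]] := exists_invariant_inner_product rho_rep n_gt0 rho_Gamma.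
have [vs [vs_compat vs_complete]] :=
  exists_cyclic_family rho_rep n_gt0 rho_Gamma zeta_prim ipP ip_rho.
have [b [b_eigen b_complete]] := exists_real_eigenfamily rho_rep n_gt0 rho_Gamma
  zeta_prim ipP ip_rho vs_compat vs_complete.
exists (size b), (basis_matrix rho ip b); split; last first.
  exact: equivalent_to_basis_matrix b_eigen b_complete.
split.
- split=> [g||g h].
  + exact: (basis_matrix_unitary rho_rep ipP ip_rho b_eigen b_complete).
  + exact: (basis_matrix1 rho_rep ipP b_eigen).
  + exact: (basis_matrixM rho_rep ipP b_eigen b_complete).
- exact: (basis_matrix_s_sym rho_rep ipP ip_rho vs_compat b_eigen).
- exact: (basis_matrix_t_diag ipP b_eigen).
Qed.
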